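(* For every integer $m\geq1$, $$B_{2^m}=\bigcup_{k=0}^{2^m-1}E_{-k}(2^mB_1),\qquad C_{2^m}=\bigcup_{k=0}^{2^m-1}E_{-k}(2^mC_1),$$ i.e. $B_{2^m}=\{2^mb+k: b\in B_1,\ 0\le k\le 2^m-1\}$ and $C_{2^m}=\{2^mc+k: c\in C_1,\ 0\le k\le 2^m-1\}$.
   Context: $\mathbb{N}_0=\{0,1,2,\dots\}$. $t(n)$ is the Thue–Morse sequence: $t(n)=0$ if the binary expansion of $n$ has an even number of $1$'s, $t(n)=1$ otherwise. For $a\ge1$, $B_a=\{x\in\mathbb{N}_0: t(x+a)=1-t(x)\}$ and $C_a=\{x\in\mathbb{N}_0: t(x+a)=t(x)\}$. For a set of integers $A$ and $h\in\mathbb{Z}$, $E_h(A)=\{y-h: y\in A\}$, and for an integer $q$, $qA=\{qy:y\in A\}$. *)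

(* Defs.v *)
From mathcomp Require Import all_boot all_order all_algebra.
From mathcomp Require Import classical_sets.

Set Implicit Arguments.
Unset Strict Implicit.
Unset Printing Implicit Defensive.

Import Order.TTheory GRing.Theory Num.Theory.

Local Open Scope classical_set_scope.
Local Open Scope ring_scope.

Definition binary_digit (n i : nat) : nat := ((n %/ 2 ^ i) %% 2)%N.

(* Since n < 2 ^ n, every nonzero binary digit of n has an index i < n. *)
Definition binary_ones (n : nat) : nat :=
  #|[set i : 'I_n | binary_digit n i == 1%N]%SET|.

Definition thue_morse (n : nat) : nat :=
  if odd (binary_ones n) then 1%N else 0%N.

(* B_a and C_a are sets of natural numbers, viewed as sets of integers so that
   they can be shifted by any integer. As thue_morse takes only the values 0
   and 1, the natural number subtraction below is never truncated. *)
Definition tm_diff (a : nat) : set int :=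
  [set x%:Z | x in [set x : nat |
     thue_morse (x + a) = (1 - thue_morse x)%N]].

Definition tm_same (a : nat) : set int :=
  [set x%:Z | x in [set x : nat | thue_morse (x + a) = thue_morse x]].

Definition shift_set (h : int) (A : set int) : set int := [set y - h | y in A].

Definition dilate_set (q : int) (A : set int) : set int := [set q * y | y in A].

(* Main.v *)
Require Import Defs.
From mathcomp Require Import all_boot all_order all_algebra.
From mathcomp Require Import classical_sets.

Import Order.TTheory GRing.Theory Num.Theory.

Local Open Scope classical_set_scope.
Local Open Scope ring_scope.

(* The binary digits of [2 ^ m * b + k], for [k < 2 ^ m], are those of [k]
   followed by those of [b], so [t (2 ^ m * b + k) = t b + t k] modulo 2. Adding
   [2 ^ m] replaces [b] by [b + 1] and keeps [k]: whether [t] changes depends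
   only on the quotient [b]. *)

Lemma binary_digit_small (n i : nat) : (n < 2 ^ i)%N -> binary_digit n i = 0%N.
Proof. by move=> ni; rewrite /binary_digit divn_small. Qed.

(** Digits of index [i >= n] vanish because [n < 2 ^ n <= 2 ^ i]. The freedom in [N] lets numbers of
    different sizes be summed over compatible index ranges. *)
Lemma binary_onesE (n N : nat) :
  (n <= N)%N -> binary_ones n = (\sum_(i < N) binary_digit n i)%N.
Proof.
move=> nN; rewrite /binary_ones cardsE -sum1_card big_mkcond.
transitivity (\sum_(i < n) binary_digit n i)%N.
  apply: eq_bigr => i _; rewrite unfold_in /binary_digit modn2.
  by case: odd.
rewrite (big_ord_widen N (binary_digit n) nN) big_mkcond /=.
apply: eq_bigr => i _; case: ltnP => // ni; rewrite binary_digit_small //.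
by rewrite (leq_trans (ltn_expl n (ltnSn 1))) // leq_exp2l.
Qed.

Lemma binary_digit_low (m b k i : nat) :
  (i < m)%N -> binary_digit (2 ^ m * b + k) i = binary_digit k i.
Proof.
(* As [i < m], dividing [2 ^ m * b] by [2 ^ i] leaves an even number, invisible modulo 2. *)
move=> im; have -> : (2 ^ m * b = 2 ^ (m - i.+1) * b * 2 * 2 ^ i)%N.
  by rewrite -[RHS]mulnA -expnS mulnAC -expnD subnK.
by rewrite /binary_digit divnMDl ?expn_gt0 // modnMDl.
Qed.

Lemma binary_digit_high (m b k i : nat) :
  (k < 2 ^ m)%N -> binary_digit (2 ^ m * b + k) (m + i) = binary_digit b i.
Proof.
move=> km; rewrite /binary_digit expnD divnMA mulnC divnMDl ?expn_gt0 //.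
by rewrite (divn_small km) addn0.
Qed.

Lemma binary_ones_cat (m b k : nat) : (k < 2 ^ m)%N ->
  binary_ones (2 ^ m * b + k) = (binary_ones b + binary_ones k)%N.
Proof.
move=> km; have [N nN] : exists N, (2 ^ m * b + k <= N)%N.
  by exists (2 ^ m * b + k)%N.
have bN : (b <= N)%N.
  by rewrite (leq_trans _ (leq_trans (leq_addr _ _) nN)) // leq_pmull // expn_gt0.
have kN : (k <= N)%N by exact: leq_trans (leq_addl _ _) nN.
(* Range [m + N] for the sum and for [k], but [N] for [b]: once the first two are cut at [m], the
   upper block has exactly the indices of [b]. *)
rewrite (binary_onesE _ (m + N)) ?(leq_trans nN) ?leq_addl //.
rewrite (binary_onesE _ _ bN) (binary_onesE k (m + N)) ?(leq_trans kN) ?leq_addl //.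
rewrite !big_split_ord /= [in RHS]addnC -addnA; congr (_ + _)%N.
  by apply: eq_bigr => i _; exact: binary_digit_low.
(* The upper block of [k] is zero since [k < 2 ^ m]. *)
rewrite [X in _ = (X + _)%N]big1 ?add0n => [|i _].
  by apply: eq_bigr => i _; exact: binary_digit_high.
apply: binary_digit_small; apply: (leq_trans km).
by rewrite leq_exp2l // leq_addr.
Qed.

Lemma thue_morse_diffE (x y : nat) :
  thue_morse x = (1 - thue_morse y)%N <->
  odd (binary_ones x) = ~~ odd (binary_ones y).
Proof. by rewrite /thue_morse; do 2 case: odd. Qed.

Lemma thue_morse_sameE (x y : nat) :
  thue_morse x = thue_morse y <->
  odd (binary_ones x) = odd (binary_ones y).
Proof. by rewrite /thue_morse; do 2 case: odd. Qed.

(** Since [2 ^ m * b + k + 2 ^ m = 2 ^ m * (b + 1) + k], the parity contributed by [k] occurs twice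
    and cancels. *)
Lemma odd_binary_ones_shift (m b k : nat) : (k < 2 ^ m)%N ->
  odd (binary_ones (2 ^ m * b + k + 2 ^ m)) (+) odd (binary_ones (2 ^ m * b + k))
  = odd (binary_ones (b + 1)) (+) odd (binary_ones b).
Proof.
move=> km; rewrite addnAC -[X in (_ + X + _)%N]muln1 -mulnDr.
by rewrite !binary_ones_cat // !oddD; do 3 case: odd.
Qed.

(** Euclidean division by [q]: membership in [P] is decided by the quotient alone, and every
    remainder occurs. Serves both $B$ and $C$. *)
Lemma image_Posz_divn (q : nat) (P Q : set nat) : (0 < q)%N ->
  (forall b k, (k < q)%N -> P (q * b + k)%N <-> Q b) ->
  [set x%:Z | x in P] =
  [set x : int | exists (b : int) (k : nat),
     [/\ [set y%:Z | y in Q] b, (0 <= k <= q - 1)%N & x = q%:Z * b + k%:Z]].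
Proof.
move=> q0 PQ; apply/seteqP; split => [_ [x Px <-]|_ [_] [k] [[b Qb <-] kq ->]].
  have kq : (x %% q < q)%N by rewrite ltn_mod.
  exists (x %/ q)%N%:Z, (x %% q)%N; split.
  - by exists (x %/ q)%N => //; apply/(PQ _ _ kq); rewrite mulnC -divn_eq.
  - by rewrite leq0n subn1 -ltnS prednK.
  - by rewrite -PoszM -PoszD mulnC -divn_eq.
exists (q * b + k)%N; last by rewrite PoszD PoszM.
by apply/PQ => //; rewrite -(prednK q0) ltnS -subn1.
Qed.

Lemma bigcup_shift_dilate (q : int) (n : nat) (A : set int) :
  \bigcup_(k in [set k : nat | (0 <= k <= n)%N])
    shift_set (- k%:Z) (dilate_set q A) =
  [set x : int | exists (b : int) (k : nat),
     [/\ A b, (0 <= k <= n)%N & x = q * b + k%:Z]].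
Proof.
apply/seteqP; split => [_ [k kn [_ [b Ab <-] <-]]|_ [b] [k] [Ab kn ->]].
  by exists b, k; rewrite opprK.
by exists k => //; exists (q * b); [exists b | rewrite opprK].
Qed.

Theorem theorem5 (m : nat) (hm : (1 <= m)%N) :
  [/\ tm_diff (2 ^ m)%N =
        \bigcup_(k in [set k : nat | (0 <= k <= 2 ^ m - 1)%N])
          shift_set (- k%:Z) (dilate_set (2 ^+ m) (tm_diff 1)),
      tm_same (2 ^ m)%N =
        \bigcup_(k in [set k : nat | (0 <= k <= 2 ^ m - 1)%N])
          shift_set (- k%:Z) (dilate_set (2 ^+ m) (tm_same 1)),
      tm_diff (2 ^ m)%N =
        [set x : int | exists (b : int) (k : nat),
          [/\ tm_diff 1 b, (0 <= k <= 2 ^ m - 1)%N & x = 2 ^+ m * b + k%:Z]] &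
      tm_same (2 ^ m)%N =
        [set x : int | exists (c : int) (k : nat),
          [/\ tm_same 1 c, (0 <= k <= 2 ^ m - 1)%N & x = 2 ^+ m * c + k%:Z]]].
Proof.
have q0 : (0 < 2 ^ m)%N by rewrite expn_gt0.
have qE : 2 ^+ m = (2 ^ m)%N%:Z :> int by rewrite -natrX natz.
rewrite !bigcup_shift_dilate qE.
(* With the unions made explicit, only two distinct equalities remain. The xor identity says that
   both parities flip or neither does, which settles each by cases on the four parities. *)
by split; apply: (image_Posz_divn _ _ _ q0) => b k km /=;
  have := odd_binary_ones_shift m b k km;
  rewrite ?(thue_morse_diffE, thue_morse_sameE); do 4 case: odd.
Qed.
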